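(* Let $1\le k\le n$ be integers and let $B\in\mathbb{R}^{k\times k}$ be symmetric positive definite. Then the Euclidean distance degree of the Cholesky model $\mathrm{V}_B(k,n)=\{X\in\mathbb{R}^{n\times k}:X^{\mathsf T}X=B\}$ of the Stiefel manifold is \[ \mathsf{ED}\bigl(\mathrm{V}_B(k,n)\bigr)=2^k. \]
   Context: The complex locus of $\mathrm{V}_B(k,n)$ is $\mathrm{V}_B(k,n)^{\mathbb{C}}=\{X\in\mathbb{C}^{n\times k}:X^{\mathsf T}X=B\}$ (transpose, not conjugate transpose); it is a smooth affine variety. Euclidean distance degree: for a real affine variety $\mathcal{M}\subseteq \mathbb{R}^{n\times k}$ with smooth complex locus $\mathcal{M}^{\mathbb{C}}\subseteq\mathbb{C}^{n\times k}$ (the complex solutions of the same defining equations), and $A\in\mathbb{R}^{n\times k}$, let $\delta_A:\mathcal{M}^{\mathbb{C}}\to\mathbb{C}$, $\delta_A(X)=\tfrac12\sum_{i,j}(x_{ij}-a_{ij})^2$ (no absolute values). A point $X\in\mathcal{M}^{\mathbb{C}}$ is stationary if $\operatorname{tr}(Y^{\mathsf T}(X-A))=0$ for all $Y$ in the tangent space $\mathbb{T}_X\mathcal{M}^{\mathbb{C}}$. Then $\mathsf{ED}(\mathcal{M})=N$ means that for generic $A$ (all $A\in\mathbb{R}^{n\times k}$ outside some proper real algebraic subset) $\delta_A$ has exactly $N$ stationary points in $\mathcal{M}^{\mathbb{C}}$. *)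

(* Defs.v *)
From HB Require Import structures.
From mathcomp Require Import all_boot all_order all_algebra.
From mathcomp Require Import reals.
From mathcomp.real_closed Require Import complex.
From mathcomp.multinomials Require Import mpoly.

Set Implicit Arguments.
Unset Strict Implicit.
Unset Printing Implicit Defensive.

Import Order.TTheory GRing.Theory Num.Theory.
Local Open Scope ring_scope.
Local Open Scope complex_scope.

(* A polynomial in the entries x_ij of an n x k matrix is an element of
   {mpoly K[n * k]}; the variable x_ij has index [mxvec_index i j]. *)
Notation mxpolyring K n k := {mpoly K[(n * k)%N]}.

Definition mxeval (K : comNzRingType) (n k : nat)
    (f : mxpolyring K n k) (X : 'M[K]_(n, k)) : K :=
  f.@[mxvec X 0].

(* A real affine variety is given by finitely many defining equations, since
   its complex locus depends on the equations and not only on the real zeros. *)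
Definition affine_variety (R : realType) (n k : nat) := seq (mxpolyring R n k).

Definition real_locus (R : realType) (n k : nat) (M : affine_variety R n k)
    (X : 'M[R]_(n, k)) : Prop :=
  forall f, f \in M -> mxeval f X = 0.

Definition complex_locus (R : realType) (n k : nat) (M : affine_variety R n k)
    (X : 'M[R[i]]_(n, k)) : Prop :=
  forall f, f \in M -> mxeval (map_mpoly (real_complex R) f) X = 0.

(* Tangent space at X of the reduced variety Z: the vectors killed by the
   differential at X of every complex polynomial vanishing on Z. *)
Definition tangent_space (R : realType) (n k : nat)
    (Z : 'M[R[i]]_(n, k) -> Prop) (X Y : 'M[R[i]]_(n, k)) : Prop :=
  forall f : mxpolyring R[i] n k,
    (forall X', Z X' -> mxeval f X' = 0) ->
    \sum_(i < n) \sum_(j < k) mxeval (mderiv (mxvec_index i j) f) X * Y i j = 0.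

(* Stationary points on the complex locus of
   delta_A(X) = 1/2 * \sum_(i, j) (x_ij - a_ij)^2. *)
Definition stationary (R : realType) (n k : nat) (M : affine_variety R n k)
    (A : 'M[R]_(n, k)) (X : 'M[R[i]]_(n, k)) : Prop :=
  complex_locus M X /\
  forall Y, tangent_space (complex_locus M) X Y ->
    \tr (Y^T *m (X - map_mx (real_complex R) A)) = 0.

(* [G] is the proper real algebraic subset of exceptional data points. *)
Definition ED_degree (R : realType) (n k : nat) (M : affine_variety R n k)
    (N : nat) : Prop :=
  exists G : affine_variety R n k,
    (exists A, ~ real_locus G A) /\
    forall A, ~ real_locus G A ->
      exists s : seq 'M[R[i]]_(n, k),
        [/\ uniq s, size s = N & forall X, X \in s <-> stationary M A X].

Definition posdefmx (R : realType) (k : nat) (B : 'M[R]_k) : Prop :=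
  forall v : 'cV[R]_k, v != 0 -> 0 < (v^T *m B *m v) 0 0.

Definition cholesky_eq (R : realType) (n k : nat) (B : 'M[R]_k) (i j : 'I_k) :
    mxpolyring R n k :=
  \sum_(l < n) 'X_(mxvec_index l i) * 'X_(mxvec_index l j) - (B i j)%:MP.

Definition cholesky_model (R : realType) (n k : nat) (B : 'M[R]_k) :
    affine_variety R n k :=
  [seq cholesky_eq n B i j | i <- enum 'I_k, j <- enum 'I_k].

Lemma real_cholesky_modelP (R : realType) (n k : nat) (B : 'M[R]_k)
    (X : 'M[R]_(n, k)) :
  real_locus (cholesky_model n B) X <-> X^T *m X = B.
Proof.
have evE i j : mxeval (cholesky_eq n B i j) X = (X^T *m X) i j - B i j.
  rewrite /mxeval /cholesky_eq mevalB mevalC mxE; congr (_ - _).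
  rewrite (big_morph _ (mevalD _) (meval0 _)).
  by apply: eq_bigr => l _; rewrite mevalM !mevalXU !mxvecE mxE.
split=> [XP | XB f /allpairsP[[i j] /= [_ _ ->]]]; last by rewrite evE XB subrr.
apply/matrixP=> i j; apply/eqP; rewrite -subr_eq0 -evE; apply/eqP/XP.
by apply/allpairsP; exists (i, j); rewrite !mem_enum.
Qed.

Lemma complex_cholesky_modelP (R : realType) (n k : nat) (B : 'M[R]_k)
    (X : 'M[R[i]]_(n, k)) :
  complex_locus (cholesky_model n B) X <->
  X^T *m X = map_mx (real_complex R) B.
Proof.
have evE i j : mxeval (map_mpoly (real_complex R) (cholesky_eq n B i j)) X =
    (X^T *m X) i j - (map_mx (real_complex R) B) i j.
  rewrite /mxeval /cholesky_eq rmorphB /= map_mpolyC mevalB mevalC !mxE.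
  congr (_ - _); rewrite [map_mpoly _ _]rmorph_sum /=.
  rewrite (big_morph _ (mevalD _) (meval0 _)).
  apply: eq_bigr => l _.
  by rewrite rmorphM /= !map_mpolyX mevalM !mevalXU !mxvecE mxE.
split=> [XP | XB f /allpairsP[[i j] /= [_ _ ->]]]; last by rewrite evE XB subrr.
apply/matrixP=> i j; apply/eqP; rewrite -subr_eq0 -evE; apply/eqP/XP.
by apply/allpairsP; exists (i, j); rewrite !mem_enum.
Qed.

(* Main.v *)
Require Import Defs.
From mathcomp Require Import all_boot all_order all_algebra.
From mathcomp Require Import reals ring.
From mathcomp.real_closed Require Import complex.
From mathcomp.multinomials Require Import mpoly.

(* A tangent vector at X is S X with S skew, so X is stationary for A iff
   X^T X = B and A X^T = X A^T.  Write B = C^T C, X = Z C and F = A C^T.  The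
   conditions become Z^T Z = 1 and F Z^T = Z F^T, so that Q = F^T Z is a
   symmetric square root of W = F^T F, with F = Z Q.  For generic A, the matrix
   W has distinct nonzero eigenvalues; it then has exactly 2^k square roots Q,
   all of them symmetric and invertible, and Z = F Q^-1. *)

Set Implicit Arguments.
Unset Strict Implicit.
Unset Printing Implicit Defensive.

Import Order.TTheory GRing.Theory Num.Theory.
Local Open Scope ring_scope.

(** * Polynomials along rational curves *)

Section PolynomialCurves.
Variables (K : numFieldType) (m : nat).

Lemma mpoly_ring_ind (P : {mpoly K[m]} -> Prop) :
    (forall c, P c%:MP) -> (forall i, P 'X_i) ->
    (forall f g, P f -> P g -> P (f + g)) ->
    (forall f g, P f -> P g -> P (f * g)) ->
  forall f, P f.
Proof.
move=> PC PX PD PM f; rewrite [f]mpolyE.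
elim/big_ind: _ => [||a _]; [by rewrite -mpolyC0|exact: PD|].
rewrite -mul_mpolyC mpolyXE_id; apply: (PM _ _ (PC _)).
elim/big_ind: _ => [||i _]; [by rewrite -mpolyC1|exact: PM|].
elim: (a i) => [|e IHe]; first by rewrite expr0 -mpolyC1.
by rewrite exprS; apply: PM.
Qed.

(** The product [p * d] vanishes at every natural number, and in characteristic zero these are more
    roots than a nonzero polynomial can have. *)
Lemma poly_eq0_off (p d : {poly K}) :
  d != 0 -> (forall t, d.[t] != 0 -> p.[t] = 0) -> p = 0.
Proof.
move=> d0 p0; apply/eqP; apply: contraT => pn0.
have pd0 : p * d != 0 by rewrite mulf_neq0.
have := @max_poly_roots _ (p * d) [seq i%:R | i <- iota 0 (size (p * d))] pd0.
rewrite size_map size_iota ltnn; apply => //.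
  apply/allP => _ /mapP[i _ ->]; rewrite rootE hornerM mulf_eq0.
  by have [//|/p0 ->] := eqVneq d.[i%:R] 0; rewrite ?eqxx ?orbT.
rewrite map_inj_uniq ?iota_uniq // => i j /eqP.
by rewrite eqr_nat => /eqP.
Qed.

(* Clearing denominators turns [f] along the rational curve [p / d] into a
   polynomial, whose derivative at 0 is the one given by the chain rule. *)
Lemma mpoly_along_rational_curve (p : 'I_m -> {poly K}) (d : {poly K})
    (x v : 'I_m -> K) (f : {mpoly K[m]}) :
    d.[0] = 1 -> (forall i, (p i).[0] = x i) ->
    (forall i, (p i)^`().[0] = d^`().[0] * x i + v i) ->
  exists (N : nat) (F : {poly K}),
    [/\ forall t, d.[t] != 0 ->
          F.[t] = d.[t] ^+ N * f.@[fun i => (p i).[t] / d.[t]],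
        F.[0] = f.@[x]
      & F^`().[0] =
          N%:R * d^`().[0] * f.@[x] + \sum_i (mderiv i f).@[x] * v i].
Proof.
move=> d0 p0 p'0; elim/mpoly_ring_ind: f => [c|i|f g IHf IHg|f g IHf IHg].
- exists 0%N, c%:P; split=> [t _||]; rewrite ?hornerC ?mevalC ?mul1r //.
  rewrite derivC hornerC !mul0r add0r big1 // => i _.
  by rewrite mderivC meval0 mul0r.
- exists 1%N, (p i); split=> [t dt||]; rewrite ?mevalXU ?p0 //.
    by rewrite expr1 mulrC divfK.
  rewrite p'0 mul1r; congr (_ + _); rewrite (bigD1 i) //= big1.
    rewrite mderivX mnm1E eqxx scale1r -[X in (X - _)%MM]add0m addmK.
    by rewrite mpolyX0 meval1 mul1r addr0.
  move=> j ji; rewrite mderivX mnm1E eq_sym (negPf ji).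
  by rewrite scale0r meval0 mul0r.
- have [N [F [Fd F0 F'0]]] := IHf; have [M [G [Gd G0 G'0]]] := IHg.
  (* Multiplying each summand by the other's power of [d] brings both to the denominator
     [d ^+ (N + M)]. *)
  exists (N + M)%N, (F * d ^+ M + d ^+ N * G); split=> [t dt||].
  + by rewrite !hornerE Fd // Gd // mevalD exprD; ring.
  + by rewrite !hornerE d0 !expr1n F0 G0 mevalD; ring.
  + have derivX e : (d ^+ e)^`().[0] = e%:R * d^`().[0].
      by rewrite deriv_exp hornerMn hornerM horner_exp d0 expr1n mulr1 mulr_natl.
    under eq_bigr do rewrite mderivD mevalD mulrDl.
    rewrite big_split /= !derivD !derivM !hornerD !hornerM !derivX.
    by rewrite !horner_exp d0 !expr1n F0 G0 F'0 G'0 mevalD natrD; ring.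
- have [N [F [Fd F0 F'0]]] := IHf; have [M [G [Gd G0 G'0]]] := IHg.
  exists (N + M)%N, (F * G); split=> [t dt||].
  + by rewrite hornerM Fd // Gd // mevalM exprD; ring.
  + by rewrite hornerM F0 G0 mevalM.
  + under eq_bigr do rewrite mderivM mevalD !mevalM mulrDl [X in X + _]mulrAC
      -[X in _ + X]mulrA.
    rewrite big_split /= -mulr_suml -mulr_sumr.
    by rewrite derivM hornerD !hornerM F0 G0 F'0 G'0 mevalM natrD; ring.
Qed.

(** The cleared polynomial is zero off the roots of [d], hence identically zero. Its value and its
    derivative at 0 then both vanish, which leaves only the directional derivative of [f]. *)
Lemma vanishing_along_rational_curve (p : 'I_m -> {poly K}) (d : {poly K})
    (x v : 'I_m -> K) (f : {mpoly K[m]}) :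
    d.[0] = 1 -> (forall i, (p i).[0] = x i) ->
    (forall i, (p i)^`().[0] = d^`().[0] * x i + v i) ->
    (forall t, d.[t] != 0 -> f.@[fun i => (p i).[t] / d.[t]] = 0) ->
  \sum_i (mderiv i f).@[x] * v i = 0.
Proof.
move=> d0 p0 p'0 fv.
have [N [F [Fd F0 F'0]]] := mpoly_along_rational_curve f d0 p0 p'0.
have dn0 : d != 0.
  by apply: contra_eq_neq d0 => ->; rewrite horner0 eq_sym oner_neq0.
have Fz : F = 0 by apply: (poly_eq0_off dn0) => t dt; rewrite Fd // fv // mulr0.
move: F'0; rewrite -F0 Fz derivC horner0 mulr0 add0r.
by move=> <-.
Qed.

End PolynomialCurves.

(** * Power traces and the discriminant *)

Section TraceForm.
Variable k : nat.

(** The Hankel matrix of the power sums of the eigenvalues; its determinant is the discriminant of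
    the characteristic polynomial. *)
Definition power_trace_mx (K : comNzRingType) (A : 'M[K]_k) : 'M[K]_k :=
  \matrix_(i, j) \tr (A ^+ (i + j)).

(* Up to the factor [\det A], the discriminant of the characteristic
   polynomial, written so that it visibly commutes with ring morphisms. *)
Definition spectral_disc (K : comNzRingType) (A : 'M[K]_k) : K :=
  \det A * \det (power_trace_mx A).

Lemma map_spectral_disc (K L : comNzRingType) (h : {rmorphism K -> L})
    (A : 'M[K]_k) :
  spectral_disc (map_mx h A) = h (spectral_disc A).
Proof.
rewrite /spectral_disc rmorphM -!det_map_mx; congr (_ * \det _).
by apply/matrixP=> i j; rewrite !mxE -trace_map_mx rmorphXn.
Qed.

(** The power traces are power sums of the entries of [D], so their matrix is the Vandermonde matrix
    times its transpose. *)
Lemma spectral_disc_diag (K : fieldType) (P : 'M[K]_k) (D : 'rV[K]_k) :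
    P \in unitmx ->
  spectral_disc (invmx P *m diag_mx D *m P) =
    \det (diag_mx D) * \det (Vandermonde k D) ^+ 2.
Proof.
move=> Pu; rewrite /spectral_disc; congr (_ * _).
  by rewrite !det_mulmx mulrAC -det_mulmx mulVmx // det1 mul1r.
have powE e : (invmx P *m diag_mx D *m P) ^+ e =
    invmx P *m diag_mx (\row_i D 0 i ^+ e) *m P.
  elim: e => [|e IHe].
    rewrite expr0 (_ : diag_mx _ = 1%:M) ?mulmx1 ?mulVmx //.
    by apply/matrixP=> i j; rewrite !mxE expr0.
  rewrite exprS IHe -[LHS]/(_ *m _) !mulmxA mulmxK // -!mulmxA; congr (_ *m _).
  rewrite mulmxA; congr (_ *m _); rewrite mulmx_diag; congr (diag_mx _).
  by apply/rowP=> i; rewrite !mxE exprS.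
rewrite expr2 -[X in _ = _ * X]det_tr -det_mulmx; congr (\det _).
apply/matrixP=> i j; rewrite !mxE powE mxtrace_mulC mulmxA mulmxV // mul1mx.
by rewrite mxtrace_diag; apply: eq_bigr => l _; rewrite !mxE exprD.
Qed.

Lemma det_Vandermonde_neq0 (K : fieldType) (D : 'rV[K]_k) :
  (\det (Vandermonde k D) != 0) = injectiveb (fun i => D 0 i).
Proof.
rewrite det_Vandermonde; apply/idP/injectiveP => [Dn0 i j Dij|Dinj].
  apply/eqP; apply: contraT => ij.
  wlog ltij : i j Dij ij / (i < j)%N.
    move=> W; have:= ij; rewrite -val_eqE neq_ltn /= => /orP[|] lt; first exact: W lt.
    by apply: (W j i); rewrite // eq_sym.
  by rewrite (bigD1 i) //= (bigD1 j) //= Dij subrr !mul0r eqxx in Dn0.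
apply/prodf_neq0 => i _; apply/prodf_neq0 => j ij.
rewrite subr_eq0; apply: contraTneq ij => /Dinj ->.
by rewrite ltnn.
Qed.

End TraceForm.

(** * Square roots of a diagonalizable matrix with distinct nonzero eigenvalues *)

Lemma diag_mx_inj (K : nzRingType) (k : nat) :
  injective (@diag_mx K k).
Proof.
move=> d e /matrixP de; apply/rowP=> i.
by have := de i i; rewrite !mxE eqxx !mulr1n.
Qed.

Section SquareRoots.
Variables (K : numClosedFieldType) (n k : nat).
Variables (P : 'M[K]_k) (D : 'rV[K]_k).
Hypotheses (Pu : P \in unitmx) (Dinj : injective (fun i => D 0 i)).
Hypothesis Dn0 : forall i, D 0 i != 0.

Let W := invmx P *m diag_mx D *m P.

Definition sign_root (e : {ffun 'I_k -> bool}) : 'rV[K]_k :=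
  \row_i ((-1) ^+ e i * sqrtC (D 0 i)).

Lemma sign_root_sqr e i : sign_root e 0 i ^+ 2 = D 0 i.
Proof. by rewrite mxE exprMn sqrr_sign mul1r sqrtCK. Qed.

Lemma sign_root_neq0 e i : sign_root e 0 i != 0.
Proof. by rewrite -sqrf_eq0 sign_root_sqr. Qed.

Lemma sign_root_inj : injective sign_root.
Proof.
move=> e e' /rowP ee'; apply/ffunP=> i; have := ee' i; rewrite !mxE.
have s0 : sqrtC (D 0 i) != 0 by rewrite sqrtC_eq0.
by move=> /(mulIf s0) /signr_inj.
Qed.

Definition conj_root e := invmx P *m diag_mx (sign_root e) *m P.

Lemma conj_root_sqr e : conj_root e *m conj_root e = W.
Proof.
rewrite /conj_root /W !mulmxA mulmxK // -!mulmxA; congr (_ *m _).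
rewrite mulmxA; congr (_ *m _); rewrite mulmx_diag; congr (diag_mx _).
by apply/rowP=> i; rewrite mxE -expr2 sign_root_sqr.
Qed.

Lemma conj_root_unit e : conj_root e \in unitmx.
Proof.
rewrite !unitmx_mul unitmx_inv Pu /= andbT unitmxE det_diag unitfE.
by apply/prodf_neq0 => i _; apply: sign_root_neq0.
Qed.

Lemma conj_root_inj : injective conj_root.
Proof.
move=> e e' ee'; apply: sign_root_inj; apply: diag_mx_inj.
have: P *m conj_root e *m invmx P = P *m conj_root e' *m invmx P by rewrite ee'.
by rewrite /conj_root !mulmxA !mulmxV // !mul1mx !mulmxK.
Qed.

(** Entry [(i, j)] of the commutator is [T i j * (D 0 j - D 0 i)], and the entries of [D] are
    distinct. *)
Lemma comm_diag_mx_diag (T : 'M[K]_k) :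
  T *m diag_mx D = diag_mx D *m T -> T = diag_mx (\row_i T i i).
Proof.
move=> /matrixP TD; apply/matrixP=> i j; rewrite !mxE.
have [->|ij] := eqVneq i j; first by rewrite mulr1n.
have := TD i j; rewrite mul_mx_diag mul_diag_mx !mxE [RHS]mulrC.
rewrite mulr0n => /eqP; rewrite -subr_eq0 -mulrBr mulf_eq0 => /orP[/eqP //|].
by rewrite subr_eq0 => /eqP /Dinj ji; rewrite ji eqxx in ij.
Qed.

(** A root commutes with its own square, so it is diagonal in the basis that diagonalizes [W], and
    each diagonal entry is one of the two roots of an eigenvalue. *)
Lemma sqr_conj_root (Q : 'M[K]_k) : Q *m Q = W -> exists e, Q = conj_root e.
Proof.
move=> QQ; pose T := P *m Q *m invmx P.
have QE : Q = invmx P *m T *m P by rewrite /T !mulmxA mulVmx // mul1mx mulmxKV.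
have TT : T *m T = diag_mx D.
  rewrite /T !mulmxA mulmxKV // -(mulmxA P) QQ /W !mulmxA mulmxV // mul1mx mulmxK //.
clearbody T; have TE : T = diag_mx (\row_i T i i).
  by apply: comm_diag_mx_diag; rewrite -TT mulmxA.
have T2 i : T i i ^+ 2 = D 0 i.
  have : diag_mx (\row_i T i i) *m diag_mx (\row_i T i i) = diag_mx D by rewrite -TE.
  by rewrite mulmx_diag => /diag_mx_inj/rowP/(_ i) <-; rewrite !mxE expr2.
(* The sign is negative exactly where the diagonal entry differs from the principal root. *)
exists [ffun i => T i i != sqrtC (D 0 i)].
rewrite QE [in LHS]TE /conj_root; congr (_ *m diag_mx _ *m _); apply/rowP=> i.
rewrite !mxE ffunE; have [->|ne] := eqVneq; first by rewrite mul1r.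
have /eqP := T2 i; rewrite -[D 0 i]sqrtCK eqf_sqr (negPf ne) /= => /eqP ->.
by rewrite sqrtCK expr1 mulN1r.
Qed.

Hypothesis Wsym : W^T = W.

(* [P *m P^T] commutes with [diag_mx D], so it is diagonal and commutes with
   every diagonal matrix; hence roots of the symmetric [W] are symmetric. *)
Lemma conj_root_sym e : (conj_root e)^T = conj_root e.
Proof.
have trE (E : 'rV[K]_k) : (invmx P *m diag_mx E *m P)^T =
    P^T *m diag_mx E *m invmx P^T.
  by rewrite !trmx_mul tr_diag_mx trmx_inv mulmxA.
have PTu : P^T \in unitmx by rewrite unitmx_tr.
have swap (E : 'rV[K]_k) : P *m P^T *m diag_mx E = diag_mx E *m (P *m P^T) <->
    (invmx P *m diag_mx E *m P)^T = invmx P *m diag_mx E *m P.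
  rewrite trE; split=> [PE|PE].
    apply: (can_inj (mulKmx Pu)); apply: (can_inj (mulmxK PTu)).
    by rewrite !mulmxA mulmxKV // PE mulmxV // mul1mx mulmxA.
  have : P *m (P^T *m diag_mx E *m invmx P^T) *m P^T =
    P *m (invmx P *m diag_mx E *m P) *m P^T by rewrite PE.
  by rewrite !mulmxA mulmxKV // mulmxV // mul1mx.
have /swap/comm_diag_mx_diag PPE := Wsym.
by apply/swap; rewrite PPE diag_mxC.
Qed.

Lemma orthonormal_critical_points (F : 'M[K]_(n, k)) : F^T *m F = W ->
  exists s : seq 'M[K]_(n, k),
    [/\ uniq s, size s = (2 ^ k)%N
      & forall Z, Z \in s <-> Z^T *m Z = 1%:M /\ F *m Z^T = Z *m F^T].
Proof.
move=> FF; exists [seq F *m invmx (conj_root e) | e <- enum {: {ffun 'I_k -> bool}}].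
split.
- rewrite map_inj_uniq ?enum_uniq // => e e' FQ; apply: conj_root_inj.
  (* Applying [F^T] recovers the root from the point, since [F^T F Q^-1 = Q Q Q^-1 = Q]. *)
  have : F^T *m (F *m invmx (conj_root e)) = F^T *m (F *m invmx (conj_root e')).
    by rewrite FQ.
  by rewrite !mulmxA FF -{1}(conj_root_sqr e) -{1}(conj_root_sqr e')
    !mulmxK ?conj_root_unit.
- by rewrite size_map -cardE card_ffun card_bool card_ord.
move=> Z; split=> [/mapP[e _ ->]|[ZZ FZ]].
  have Qu := conj_root_unit e; rewrite !trmx_mul trmx_inv conj_root_sym.
  split; last by rewrite mulmxA.
  by rewrite -!mulmxA (mulmxA F^T) FF -(conj_root_sqr e) mulmxK // mulVmx.
have FE : F = Z *m (F^T *m Z) by rewrite mulmxA -FZ -mulmxA ZZ mulmx1.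
have Qsym : (F^T *m Z)^T = F^T *m Z.
  by rewrite trmx_mul trmxK {1}FE [LHS]mulmxA ZZ mul1mx.
have [|e Qe] := @sqr_conj_root (F^T *m Z).
  by rewrite -FF {4}FE [RHS]mulmxA.
apply/mapP; exists e; first by rewrite mem_enum.
by rewrite {1}FE Qe mulmxK // conj_root_unit.
Qed.

End SquareRoots.

(** * Cholesky factorization *)

Lemma cholesky_factor (R : realType) (k : nat) (B : 'M[R]_k) :
  B^T = B -> posdefmx B -> exists2 C : 'M[R]_k, C \in unitmx & C^T *m C = B.
Proof.
elim: k B => [|k IHk] B Bsym Bpos.
  by exists 1%:M; [rewrite unitmx1 | apply/matrixP=> -[]].
move: B Bsym Bpos; rewrite -[k.+1]/(1 + k)%N => B Bsym Bpos.
pose b := B 0 0; pose u : 'rV[R]_k := ursubmx B; pose B' := drsubmx B.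
have ulB : ulsubmx B = b%:M.
  by rewrite [LHS]mx11_scalar !mxE; congr (B _ _)%:M; apply/val_inj.
have dlB : dlsubmx B = u^T by rewrite -{1}Bsym -trmx_ursub.
have B'sym : B'^T = B' by rewrite /B' trmx_drsub Bsym.
have BE : B = block_mx b%:M u u^T B' by rewrite -ulB -dlB submxK.
have b0 : 0 < b.
  have := Bpos (delta_mx 0 0); rewrite BE.
  have -> : delta_mx 0 0 = col_mx 1%:M 0 :> 'cV[R]_(1 + k).
    apply/colP=> i; rewrite !mxE; case: splitP => j ji; rewrite !mxE.
      by rewrite -val_eqE /= ji !ord1 eqxx.
    by rewrite -val_eqE /= ji.
  rewrite tr_col_mx mul_row_block mul_row_col trmx0 trmx1 !mul0mx mulmx0 !addr0.
  rewrite mul1mx mulmx1 !mxE eqxx mulr1n; apply.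
  by rewrite col_mx_eq0 negb_and matrix_nonzero1.
(* The induction passes to the Schur complement of the corner entry [b]. *)
pose S := B' - b^-1 *: (u^T *m u).
have [||C Cu CS] := IHk S.
- by rewrite linearB linearZ /= trmx_mul trmxK B'sym.
(* Completing the square: this [w] solves [b w + u v = 0], so the form of [B] at [(w, v)] reduces to
   that of [S] at [v]. *)
- move=> v v0; pose w := - b^-1 *: (u *m v).
  have := Bpos (col_mx w v); rewrite col_mx_eq0 negb_and v0 orbT => /(_ isT).
  suff -> : ((col_mx w v)^T *m B *m col_mx w v) = v^T *m S *m v by [].
  rewrite BE tr_col_mx mul_row_block mul_row_col /w /S.
  rewrite !linearZ /= !trmx_mul mul_mx_scalar scalerA mulrN mulfV ?gt_eqF //.
  rewrite scaleN1r addNr mul0mx scaler0 add0r -scalemxAl scalerN -scaleNr.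
  by rewrite mulmxDr -scalemxAr !mulmxA addrC.
pose r := Num.sqrt b.
have r0 : r != 0 by rewrite gt_eqF // sqrtr_gt0.
have rr : r * r = b by rewrite -expr2 sqr_sqrtr // ltW.
(* The first row accounts for [b], [u] and [b^-1 u^T u]; the block [C] supplies the remaining
   [S]. *)
exists (block_mx r%:M (r^-1 *: u) 0 C).
  rewrite unitmxE det_ublock det_scalar1 unitrM -unitmxE Cu andbT.
  by rewrite unitfE.
rewrite BE tr_block_mx mulmx_block tr_scalar_mx !trmx0 !mul0mx !addr0 mulmx0 addr0.
have -> : (r^-1 *: u)^T = r^-1 *: u^T by rewrite linearZ.
rewrite CS !mul_scalar_mx mul_mx_scalar -!scalemxAl -!scalemxAr !scalerA.
rewrite mulfV // -invfM scale_scalar_mx rr !scale1r.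
by congr block_mx; rewrite /S addrC subrK.
Qed.

(** * Velocities of orthogonal motions *)

Section SkewTangents.
Variables (K : numFieldType) (n k : nat).
Local Notation toP := (map_mx (@polyC K)).

(* The curve is the Cayley transform [t |-> (1 - t S)^-1 (1 + t S) X], whose
   velocity at 0 is [2 S X]. *)
Lemma skew_velocity (S : 'M[K]_n) (X : 'M[K]_(n, k)) (f : mxpolyring K n k) :
    S^T = - S ->
    (forall O : 'M[K]_n, O^T *m O = 1%:M -> mxeval f (O *m X) = 0) ->
  \sum_i \sum_j mxeval (mderiv (mxvec_index i j) f) X * (S *m X) i j = 0.
Proof.
move=> Sskew fv.
pose M : 'M[{poly K}]_n := 1%:M - 'X *: toP S.
pose M' : 'M[{poly K}]_n := 1%:M + 'X *: toP S.
(* The adjugate replaces the inverse so that [Q] has polynomial entries; the curve itself is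
   [Q / d]. *)
pose Q := \adj M *m M' *m toP X; pose d := \det M.
have evM t : map_mx (horner_eval t) M = 1%:M - t *: S.
  apply/matrixP=> i j; rewrite !mxE /horner_eval !hornerE.
  by case: (i == j); rewrite ?hornerE.
have evM' t : map_mx (horner_eval t) M' = 1%:M + t *: S.
  apply/matrixP=> i j; rewrite !mxE /horner_eval !hornerE.
  by case: (i == j); rewrite ?hornerE.
have evX t : map_mx (horner_eval t) (toP X) = X.
  by apply/matrixP=> i j; rewrite !mxE /horner_eval hornerC.
have evd t : d.[t] = \det (1%:M - t *: S) by rewrite -evM det_map_mx.
have evQ t : map_mx (horner_eval t) Q = \adj (1%:M - t *: S) *m (1%:M + t *: S) *m X.
  by rewrite !map_mxM map_mx_adj evM evM' evX.
have d0 : d.[0] = 1 by rewrite evd scale0r subr0 det1.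
have Q0 : map_mx (horner_eval 0) Q = X.
  by rewrite evQ scale0r subr0 addr0 adj1 !mul1mx.
have MQ : M *m Q = d *: (M' *m toP X).
  by rewrite /Q !mulmxA mul_mx_adj mul_scalar_mx -scalemxAl.
(* Differentiating [M Q = d M' X] at 0 avoids computing the derivative of the adjugate. *)
have Q'0 i j : (Q i j)^`().[0] = d^`().[0] * X i j + (2 *: S *m X) i j.
  have MQE : Q - 'X *: (toP S *m Q) = d *: (toP X + 'X *: (toP S *m toP X)).
    by move: MQ; rewrite mulmxBl mulmxDl !mul1mx -!scalemxAl.
  have ev0 : ((toP S *m Q) i j).[0] = (S *m X) i j.
    rewrite -Q0 !mxE horner_sum; apply: eq_bigr => l _.
    by rewrite !mxE hornerM hornerC.
  have ev0' : ((toP S *m toP X) i j).[0] = (S *m X) i j.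
    rewrite !mxE horner_sum; apply: eq_bigr => l _.
    by rewrite !mxE hornerM !hornerC.
  have : Q i j - 'X * (toP S *m Q) i j =
      d * ((X i j)%:P + 'X * (toP S *m toP X) i j).
    by move/matrixP/(_ i j): MQE; rewrite !mxE.
  set q := (toP S *m Q) i j in ev0 *; set q' := (toP S *m toP X) i j in ev0' *.
  move=> /(congr1 (fun p => p^`().[0])).
  have -> : (2 *: S *m X) i j = 2 * (S *m X) i j by rewrite -scalemxAl [LHS]mxE.
  rewrite derivB !derivM derivD derivM derivX derivC !hornerE /= ev0 ev0' d0 !mul1r.
  by move=> /eqP; rewrite subr_eq => /eqP ->; ring.
(* Where [d] does not vanish, [invmx N *m N'] is orthogonal because [N' = N^T] commutes with [N]. *)
have evf t : d.[t] != 0 -> f.@[fun l => (mxvec Q 0 l).[t] / d.[t]] = 0.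
  move=> dt; pose N := 1%:M - t *: S; pose N' := 1%:M + t *: S.
  have Nu : N \in unitmx by rewrite unitmxE unitfE -evd.
  have NT : N^T = N' by rewrite linearB linearZ /= Sskew trmx1 scalerN opprK.
  have N'T : N'^T = N by rewrite -NT trmxK.
  have N'u : N' \in unitmx by rewrite -NT unitmx_tr.
  have NN' : N *m N' = N' *m N.
    rewrite /N /N' mulmxBl mulmxDl !(mulmxBr, mulmxDr) !mul1mx !mulmx1.
    by rewrite addrKA subrKA.
  have O_orth : (invmx N *m N')^T *m (invmx N *m N') = 1%:M.
    have {2}-> : invmx N *m N' = N' *m invmx N.
      by apply: (can_inj (mulKmx Nu)); rewrite mulKVmx // mulmxA NN' mulmxK.
    rewrite trmx_mul trmx_inv NT N'T mulmxA -(mulmxA N) mulVmx // mulmx1.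
    by rewrite mulmxV.
  rewrite -[RHS](fv _ O_orth) /mxeval; apply: meval_eq => l.
  case/mxvec_indexP: l => i j; rewrite !mxvecE /invmx Nu.
  have -> : (Q i j).[t] = (map_mx (horner_eval t) Q) i j by rewrite [RHS]mxE.
  by rewrite evQ -!scalemxAl [RHS]mxE evd mulrC.
have := @vanishing_along_rational_curve K _ (mxvec Q 0) d (mxvec X 0)
  (mxvec (2 *: S *m X) 0) f d0.
have evp l : (mxvec Q 0 l).[0] = mxvec X 0 l.
  by case/mxvec_indexP: l => i j; rewrite !mxvecE -[in RHS]Q0 [RHS]mxE.
have evp' l : (mxvec Q 0 l)^`().[0] =
    d^`().[0] * mxvec X 0 l + mxvec (2 *: S *m X) 0 l.
  by case/mxvec_indexP: l => i j; rewrite !mxvecE.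
move=> /(_ evp evp' evf); rewrite (reindex _ (curry_mxvec_bij _ _)) /=.
rewrite pair_bigA /= => sum0; apply: (@mulfI _ 2); first by rewrite pnatr_eq0.
rewrite mulr0 -[RHS]sum0 mulr_sumr; apply: eq_bigr => -[i j] _ /=.
by rewrite mxvecE -scalemxAl [X in _ = _ * X]mxE mulrCA.
Qed.

End SkewTangents.

(** * Stationarity as matrix equations *)

Section Stationarity.
Local Open Scope complex_scope.
Variables (R : realType) (n k : nat) (B : 'M[R]_k).
Hypotheses (Bsym : B^T = B) (Bu : B \in unitmx).
Local Notation toC := (map_mx (real_complex R)).
Local Notation V := (complex_locus (cholesky_model n B)).

(** Left multiplication by an orthogonal matrix preserves [X^T X], so a polynomial vanishing on the
    locus vanishes on the whole orbit of [X]. *)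
Lemma tangent_space_skew (S : 'M[R[i]]_n) (X : 'M[R[i]]_(n, k)) :
  V X -> S^T = - S -> tangent_space V X (S *m X).
Proof.
move=> /complex_cholesky_modelP XB Sskew f fv; apply: skew_velocity => // O OO.
apply/fv/complex_cholesky_modelP.
by rewrite trmx_mul -mulmxA (mulmxA O^T) OO mul1mx.
Qed.

(** This is the differential of [X^T X = B], read off from the defining equations one entry at a
    time. *)
Lemma tangent_space_sym (X Y : 'M[R[i]]_(n, k)) :
  tangent_space V X Y -> Y^T *m X = - (X^T *m Y).
Proof.
move=> XY; apply/eqP; rewrite -addr_eq0; apply/eqP/matrixP=> a b.
pose f := map_mpoly (real_complex R) (cholesky_eq n B a b).
have fv X' : V X' -> mxeval f X' = 0.
  by apply; apply/allpairsP; exists (a, b); rewrite !mem_enum.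
rewrite [RHS]mxE -[RHS](XY f fv) !mxE -big_split /=; apply: eq_bigr => l _.
(* Only the summand of row [l] in the equation involves the variable of index [(l, j)]. *)
have dE j : mxeval (mderiv (mxvec_index l j) f) X =
    (j == a)%:R * X l b + (j == b)%:R * X l a.
  have dX l' j' : mderiv (mxvec_index l j)
      ('X_(mxvec_index l' j') : mxpolyring R[i] n k) =
      ((l == l') && (j == j'))%:R%:MP.
    rewrite mderivX mnm1E.
    have -> : (mxvec_index l' j' == mxvec_index l j) = (l == l') && (j == j').
      have [g gK _] := @curry_mxvec_bij n k.
      apply/eqP/andP => [e|[/eqP -> /eqP ->] //].
      have := gK (l', j') isT; rewrite /= e (gK (l, j) isT) => -[-> ->].
      by rewrite !eqxx.
    case: (boolP (_ && _)) => [/andP[/eqP -> /eqP ->]|_].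
      by rewrite -[X in (X - _)%MM]add0m addmK mpolyX0 scale1r mpolyC1.
    by rewrite scale0r mpolyC0.
  rewrite /mxeval /f /cholesky_eq rmorphB /= map_mpolyC.
  rewrite [map_mpoly _ _]rmorph_sum /= mderivB mderivC subr0.
  rewrite (big_morph _ (mderivD _) (mderiv0 _ _)).
  rewrite (big_morph _ (mevalD _) (meval0 _)) (bigD1 l) //= big1 => [|l' l'l].
    rewrite rmorphM /= !map_mpolyX mderivM !dX !eqxx /= mevalD !mevalM !mevalC.
    by rewrite !mevalXU !mxvecE addr0 [X in _ + X]mulrC.
  rewrite rmorphM /= !map_mpolyX mderivM !dX eq_sym (negPf l'l) /=.
  by rewrite mpolyC0 mul0r mulr0 addr0 meval0.
under eq_bigr do rewrite dE mulrDl.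
rewrite big_split /= (bigD1 a) //= [X in _ = _ + X](bigD1 b) //= !eqxx !mul1r.
rewrite !big1 ?addr0; first by rewrite !mxE; ring.
  by move=> j /negPf ->; rewrite !mul0r.
by move=> j /negPf ->; rewrite !mul0r.
Qed.

(* The normal space at [X] is [{X L | L symmetric}]; only the tangent vectors
   [S X] with [S] skew are needed to detect it. *)
Lemma cholesky_stationaryP (A : 'M[R]_(n, k)) (X : 'M[R[i]]_(n, k)) :
  stationary (cholesky_model n B) A X <->
  X^T *m X = toC B /\ toC A *m X^T = X *m (toC A)^T.
Proof.
set A' := toC A; set B' := toC B.
have B'sym : B'^T = B' by rewrite /B' map_trmx Bsym.
have B'u : B' \in unitmx by rewrite map_unitmx.
have trD (H : 'M[R[i]]_n) a b : \tr (delta_mx a b *m H) = H b a.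
  rewrite /mxtrace (bigD1 a) //= big1 => [|c ca]; rewrite !mxE.
    rewrite (bigD1 b) //= big1 => [|d db]; rewrite !mxE ?eqxx ?mul1r ?addr0 //.
    by rewrite (negPf db) andbF mul0r.
  by rewrite big1 // => d _; rewrite mxE (negPf ca) mul0r.
split=> [[XV Xst]|[XB AX]].
  split; first exact/complex_cholesky_modelP.
  (* Testing on [S X] with [S] an elementary skew matrix gives the symmetry of [H] entry by entry;
     its part [X X^T] is symmetric and cancels. *)
  pose H := (X - A') *m X^T.
  have Hsym : H^T = H.
    apply/matrixP=> i j; rewrite mxE; apply/eqP; rewrite -subr_eq0; apply/eqP.
    pose S : 'M[R[i]]_n := delta_mx i j - delta_mx j i.
    have Sskew : S^T = - S by rewrite linearB /= !trmx_delta opprB.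
    have /eqP := Xst _ (tangent_space_skew XV Sskew).
    rewrite trmx_mul Sskew mulmxN mulNmx raddfN /= oppr_eq0 -mulmxA mxtrace_mulC.
    by rewrite -mulmxA mulmxBl raddfB /= !trD => /eqP.
  move: Hsym; rewrite /H trmx_mul trmxK linearB /= mulmxBl mulmxBr.
  by move=> /addrI/oppr_inj.
split=> [|Y /tangent_space_sym YX]; first exact/complex_cholesky_modelP.
(* [L] is the Lagrange multiplier, with [X - A' = X L]; its symmetry amounts to [M^T B' = B' M]. *)
pose M := A'^T *m X; pose L := 1%:M - M *m invmx B'.
have MB : M^T *m B' = B' *m M.
  by rewrite /M trmx_mul trmxK -XB !mulmxA -(mulmxA _ A') AX !mulmxA.
have Lsym : L^T = L.
  rewrite linearB /= trmx1 trmx_mul trmx_inv B'sym; congr (_ - _).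
  by apply: (can_inj (mulKmx B'u)); rewrite mulKVmx // mulmxA -MB mulmxK.
have XL : X - A' = X *m L.
  rewrite mulmxBr mulmx1; congr (_ - _); apply: (can_inj (mulmxK B'u)).
  by rewrite !mulmxA mulmxKV // -XB mulmxA AX.
(* Since [Y^T X] is skew and [L] symmetric, the trace of their product equals its own negative. *)
rewrite XL mulmxA; apply/eqP; rewrite -eqNr -raddfN /= -mulNmx; apply/eqP.
by rewrite YX opprK -mxtrace_tr !trmx_mul trmxK Lsym mxtrace_mulC YX.
Qed.
End Stationarity.

(** * The genericity condition *)

Section Genericity.
Variables (R : realType) (n k : nat) (C : 'M[R]_k).

Definition gram_disc (A : 'M[R]_(n, k)) : R :=
  spectral_disc ((A *m C^T)^T *m (A *m C^T)).

Definition gram_disc_poly : mxpolyring R n k :=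
  let F := (\matrix_(i, j) 'X_(mxvec_index i j)) *m map_mx (@mpolyC (n * k) R) C^T in
  spectral_disc (F^T *m F).

Lemma gram_disc_polyE (A : 'M[R]_(n, k)) :
  mxeval gram_disc_poly A = gram_disc A.
Proof.
rewrite /mxeval /gram_disc_poly -map_spectral_disc !map_mxM -map_trmx !map_mxM.
have -> : map_mx (meval (mxvec A 0)) (\matrix_(i, j) 'X_(mxvec_index i j)) = A.
  by apply/matrixP=> i j; rewrite !mxE mevalXU mxvecE.
have -> : map_mx (meval (mxvec A 0)) (map_mx (@mpolyC (n * k) R) C^T) = C^T.
  by apply/matrixP=> i j; rewrite !mxE mevalC.
by [].
Qed.

Lemma gram_disc_neq0_ex : (k <= n)%N -> C \in unitmx ->
  exists A, gram_disc A != 0.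
Proof.
move=> kn Cu.
(* The Gram matrix of [E] is diagonal with distinct nonzero entries 1, 4, ..., k^2; the factor
   [invmx C^T] below makes [A C^T] equal to [E]. *)
pose E : 'M[R]_(n, k) := \matrix_(i, j) (j.+1%:R *+ (i == j :> nat)).
exists (E *m invmx C^T); rewrite /gram_disc mulmxKV ?unitmx_tr //.
pose D : 'rV[R]_k := \row_j (j.+1 ^ 2)%:R.
have -> : E^T *m E = invmx 1%:M *m diag_mx D *m 1%:M.
  rewrite invmx1 mul1mx mulmx1; apply/matrixP=> i j; rewrite !mxE.
  rewrite (bigD1 (widen_ord kn i)) //= big1 => [|l li]; rewrite !mxE /=.
    by rewrite eqxx mulr1n addr0 mulrnAr -natrM -val_eqE; case: eqP => // ->.
  suff /negPf -> : l != i :> nat by rewrite mul0r.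
  by rewrite -val_eqE in li.
rewrite spectral_disc_diag ?unitmx1 // mulf_neq0 ?expf_neq0 //.
  by rewrite det_diag; apply/prodf_neq0 => i _; rewrite mxE pnatr_eq0 expn_eq0.
rewrite det_Vandermonde_neq0; apply/injectiveP => i j; rewrite !mxE => /eqP.
by rewrite eqr_nat eqn_exp2r // eqSS => /eqP/val_inj.
Qed.

End Genericity.

(** * Counting the stationary points *)

Theorem theorem5p2 (R : realType) (n k : nat) (B : 'M[R]_k)
  (hk : (1 <= k)%N) (hkn : (k <= n)%N)
  (hBsym : B^T = B) (hBpos : posdefmx B) :
  ED_degree (cholesky_model n B) (2 ^ k)%N.
Proof.
have [C Cu CB] := cholesky_factor hBsym hBpos.
have Bu : B \in unitmx by rewrite -CB unitmx_mul unitmx_tr Cu.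
(* The exceptional data are those for which the Gram matrix of [A C^T] is singular or has a repeated
   eigenvalue. *)
exists [:: gram_disc_poly n C]; split.
  have [A A0] := gram_disc_neq0_ex hkn Cu; exists A => /(_ _ (mem_head _ _)).
  by rewrite gram_disc_polyE => /eqP; rewrite (negPf A0).
move=> A AG; have disc0 : gram_disc C A != 0.
  apply/eqP=> A0; apply: AG => g; rewrite inE => /eqP ->.
  by rewrite gram_disc_polyE.
pose C' := map_mx (real_complex R) C; pose A' := map_mx (real_complex R) A.
have C'u : C' \in unitmx by rewrite map_unitmx.
pose F := A' *m C'^T; pose W := F^T *m F.
have Wsym : W^T = W by rewrite trmx_mul trmxK.
have WE : W = map_mx (real_complex R) ((A *m C^T)^T *m (A *m C^T)).
  by rewrite map_mxM -map_trmx map_mxM -map_trmx.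
(* [W] is symmetric with real entries, hence normal, and the spectral theorem diagonalizes it. *)
have Wnormal : W \is normalmx.
  apply: symmetric_normalmx; last first.
    by apply/mxOverP=> i j; rewrite WE mxE complex_real.
  by apply/is_hermitianmxP; rewrite expr0 scale1r map_mx_id.
have WD := orthomx_spectralP Wnormal.
set P := spectralmx W in WD; set D := spectral_diag W in WD.
have Pu : P \in unitmx := spectral_unit W.
have : spectral_disc W != 0 by rewrite WE map_spectral_disc fmorph_eq0.
rewrite WD spectral_disc_diag // mulf_eq0 expf_eq0 /= negb_or.
rewrite det_Vandermonde_neq0 det_diag => /andP[/prodf_neq0 Dn0 /injectiveP Dinj].
have [|s [s_uniq s_size sP]] :=
  @orthonormal_critical_points _ n k P D Pu Dinj (fun i => Dn0 i isT) _ F WD.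
  by rewrite -WD.
exists [seq Z *m C' | Z <- s]; split; rewrite ?size_map //.
  by rewrite map_inj_uniq //; apply: (can_inj (mulmxK C'u)).
have C'B : map_mx (real_complex R) B = C'^T *m C'.
  by rewrite -CB map_mxM map_trmx.
have C'Tu : C'^T \in unitmx by rewrite unitmx_tr.
(* Under [X = Z C'], the equation [X^T X = C'^T C'] becomes [Z^T Z = 1], and [A' X^T] becomes
   [F Z^T]. *)
have scale_stationary Z : stationary (cholesky_model n B) A (Z *m C') <->
    Z^T *m Z = 1%:M /\ F *m Z^T = Z *m F^T.
  rewrite (cholesky_stationaryP hBsym Bu) C'B !trmx_mul trmxK !mulmxA.
  split=> -[ZZ AZ]; split=> //; last by rewrite -(mulmxA C'^T) ZZ mulmx1.
  apply: (can_inj (mulKmx C'Tu)); apply: (can_inj (mulmxK C'u)).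
  by rewrite mulmx1 mulmxA.
move=> X; split=> [/mapP[Z /sP ZP ->]|XP]; first exact/scale_stationary.
rewrite -[X](mulmxKV C'u) in XP *.
by apply: map_f; apply/sP/scale_stationary.
Qed.
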